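(* Let $\mathcal{P}=(p_k)_{k\in\mathbb{N}_0}$ be a sequence of integers $p_k\ge 2$ with $\sup_k p_k=\infty$, and let $(R_k)_{k\in\mathbb{N}_0}$ be the corresponding generalized Rademacher functions. Then for every integer $d\ge1$ and every $\alpha$ with $1\le\alpha<2$, the subsystem $$C^d_R=\bigl\{R_{k_0}^{j_0}\cdots R_{k_{d-1}}^{j_{d-1}} : k_0<\dots<k_{d-1},\ 1\le j_i<p_{k_i}\bigr\}$$ of the (unbounded) Vilenkin system associated with $\mathcal{P}$ is not an $\alpha$-Sidon system.
   Context: $\mathbb{N}_0=\{0,1,2,\ldots\}$. Let $\mathbb{G}_{\mathcal{P}}=\prod_{k=0}^\infty\mathbb{Z}_{p_k}$ with elements $g=(g_0,g_1,\ldots)$, $g_k\in\{0,\ldots,p_k-1\}$, equipped with normalized Haar measure. The generalized Rademacher functions are $R_k(g)=\exp(2\pi i g_k/p_k)$, $k\in\mathbb{N}_0$. Put $P_0=1$, $P_k=\prod_{j=0}^{k-1}p_j$. The Vilenkin system (the system of characters of $\mathbb{G}_{\mathcal{P}}$) consists of the functions $V_n=\prod_{k=0}^\infty R_k^{n_k}$, where $n=\sum_{k}n_kP_k$, $n_k\in\{0,\ldots,p_k-1\}$, $n\in\mathbb{N}_0$. Up to a countable set, $\mathbb{G}_{\mathcal{P}}$ is identified with $[0,1)$ with Lebesgue measure via $g\mapsto\sum_{k}g_k/P_{k+1}$. The Vilenkin system is unbounded if $\sup_kp_k=\infty$. A system of functions $(\varphi_k)$ is called $\alpha$-Sidon ($1\le\alpha<2$)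 if there is a constant $C>0$ such that for every finite sum $\sum_k c_k\varphi_k$ over distinct elements of the system with coefficients $c_k\in\mathbb{C}$, $\bigl(\sum_k|c_k|^\alpha\bigr)^{1/\alpha}\le C\,\bigl\|\sum_kc_k\varphi_k\bigr\|_{L_\infty}$. *)

(* Defs.v *)
From HB Require Import structures.
From mathcomp Require Import all_boot all_order all_algebra.
From mathcomp Require Import all_classical all_reals all_analysis.
From mathcomp Require Import complex.

Set Implicit Arguments.
Unset Strict Implicit.
Unset Printing Implicit Defensive.

Import Order.TTheory GRing.Theory Num.Theory.
Import numFieldNormedType.Exports.

Local Open Scope classical_set_scope.
Local Open Scope ring_scope.

(* The compact group G_P = prod_k Z_{p_k}, with the product of the discrete
   topologies.  Note that 'Z_n is Z/nZ only when n >= 2. *)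
Definition vilenkin_top (p : nat -> nat) : Type :=
  prod_topology (fun k => discrete_topology 'Z_(p k)).

HB.instance Definition _ p := Topological.on (vilenkin_top p).
HB.instance Definition _ p :=
  isPointed.Build (vilenkin_top p) (fun k => 0 : 'Z_(p k)).

(* The same group as a measurable space, with its Borel sigma-algebra. *)
Definition vilenkin_group (p : nat -> nat) :=
  g_sigma_algebraType (@open (vilenkin_top p)).

Definition vilenkin_add (p : nat -> nat) (h g : vilenkin_group p) :
    vilenkin_group p :=
  fun k => (h k : 'Z_(p k)) + (g k : 'Z_(p k)).

(* Being a probability, [mu] is normalized; translation invariance then
   determines it uniquely. *)
Definition haar (R : realType) (p : nat -> nat)
    (mu : probability (vilenkin_group p) R) : Prop :=
  forall (h : vilenkin_group p) (A : set (vilenkin_group p)),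
    measurable A -> mu (vilenkin_add h @` A) = mu A.

(* exp (i t) *)
Definition expi (R : realType) (t : R) : R[i] := (cos t +i* sin t)%C.

Definition rademacher (R : realType) (p : nat -> nat) (k : nat)
    (g : vilenkin_group p) : R[i] :=
  expi (2 * pi * (nat_of_ord (g k : 'Z_(p k)))%:R / (p k)%:R).

(* The functions R_{k_0}^{j_0} ... R_{k_{d-1}}^{j_{d-1}}. *)
Definition rademacher_chaos (R : realType) (p : nat -> nat) (d : nat) :
    set (vilenkin_group p -> R[i]) :=
  [set f | exists k j : 'I_d -> nat,
    [/\ {homo k : a b / (a < b)%N},
        forall a, (1 <= j a < p (k a))%N &
        f = fun g => \prod_(a < d) rademacher R (k a) g ^+ j a]].

Arguments rademacher_chaos : clear implicits.

(* [ComplexField.Normc.normc] is the modulus with values in [R] (the norm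
   `|z| of [R[i]] has values in [R[i]]). *)
Definition Linfty_norm d (T : measurableType d) (R : realType)
    (mu : {measure set T -> \bar R}) (f : T -> R[i]) : \bar R :=
  Lnorm mu +oo%E (fun x => (ComplexField.Normc.normc (f x))%:E).

(* A finite sum over distinct elements of [S] is indexed by an injective
   family of members of [S]. *)
Definition sidon d (T : measurableType d) (R : realType)
    (mu : {measure set T -> \bar R}) (S : set (T -> R[i])) (alpha : R) : Prop :=
  exists2 C : R, 0 < C &
    forall (n : nat) (phi : 'I_n -> T -> R[i]) (c : 'I_n -> R[i]),
      injective phi -> (forall a, S (phi a)) ->
      (((\sum_(a < n) ComplexField.Normc.normc (c a) `^ alpha) `^ alpha^-1)%:E
        <= C%:E * Linfty_norm mu (fun x => (\sum_(a < n) c a * phi a x)%R))%E.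

(* Main.v *)
(* With p = p_k and w = exp(2 pi i / p), the p - 1 unimodular coefficients
   w^(j^2), 1 <= j < p, on the powers R_k^j give a function of sup norm
   O(sqrt p): up to the missing term j = 0 its values are quadratic Gauss sums.
   Their l^alpha norm is (p - 1)^(1/alpha), which outgrows sqrt p as alpha < 2.
   Multiplying by the fixed unimodular R_0 ... R_(d-2) and taking k >= d - 1
   puts the example inside the chaos of order d. *)
Require Import Defs.
From mathcomp Require Import all_boot all_order all_algebra.
From mathcomp Require Import all_classical all_reals all_analysis.
From mathcomp Require Import ess_sup_inf complex zify ring lra.

Import Order.TTheory GRing.Theory Num.Theory.
Local Open Scope classical_set_scope.
Local Open Scope ring_scope.

Lemma norm_unity_root [C : numClosedFieldType] [n : nat] [w : C] :
  w ^+ n.+1 = 1 -> `|w| = 1.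
Proof.
move=> wn1; apply/eqP.
by rewrite -(@pexpr_eq1 _ _ n.+1) ?normr_ge0// -normrX wn1 normr1.
Qed.

Lemma sum_unity_root [F : idomainType] [n : nat] [z : F] :
  z ^+ n = 1 -> \sum_(i < n) z ^+ i = n%:R * (z == 1)%:R.
Proof.
move=> zn1; have [->|z_neq1] := eqVneq z 1.
  under eq_bigr do rewrite expr1n.
  by rewrite sumr_const card_ord mulr1.
rewrite mulr0; apply/eqP.
have /eqP := subrX1 z n; rewrite zn1 subrr eq_sym mulf_eq0 subr_eq0.
by rewrite (negPf z_neq1).
Qed.

(** For 0 < m < n + 1 the number 2m lies strictly between 0 and 2(n + 1), so it can only be n + 1
    itself: apart from 0, only half the modulus can contribute. *)
Lemma sum_double_dvd (n : nat) : (\sum_(m < n.+1) (n.+1 %| m.*2) <= 2)%N.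
Proof.
apply: (@leq_trans (\sum_(m < n.+1) ((m == ord0) + (m == inord n.+1./2)))).
  apply: leq_sum => m _; case: (posnP m) => [m0|m_gt0].
    by rewrite -val_eqE /= m0 eqxx; case: (_ %| _)%N.
  case: (boolP (_ %| _)%N) => // /dvdnP[q q_eq].
  have q1 : q = 1%N by have := ltn_ord m; nia.
  have -> : m = inord n.+1./2; last by rewrite eqxx leq_addl.
  by apply: val_inj; rewrite /= inordK ?uphalf_half; lia.
have sum_eq1 (i : 'I_n.+1) : (\sum_(m < n.+1) (m == i) = 1)%N.
  by rewrite (bigD1 i)//= eqxx big1// => m /negPf ->.
by rewrite big_split /= !sum_eq1.
Qed.

(* Expanding the square and substituting j = l + m makes the sum over l
   geometric, so that only the m with n | 2m contribute. *)
Lemma quadratic_sum_norm [C : numClosedFieldType] [n : nat] [w : C] (x : nat) :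
  n.-primitive_root w -> (1 < n)%N ->
  `|\sum_(j < n) w ^+ (j ^ 2 + x * j)| ^+ 2 <= n.*2%:R.
Proof.
case: n => [|[|n]]// w_prim _.
have w1 := norm_unity_root (prim_expr_order w_prim).
pose f (j : nat) := w ^+ (j ^ 2 + x * j).
have f_norm j : `|f j| = 1 by rewrite normrX w1 expr1n.
(* Here [l + m] is addition modulo n + 2, harmless in the exponent since [w] has that order. The
   cross term 2lm of the square becomes the last factor. *)
have f_add (l m : 'I_n.+2) : f (l + m)%R = f l * f m * (w ^+ m.*2) ^+ l.
  rewrite /f -exprM -!exprD /=; apply/eqP; rewrite (eq_prim_root_expr w_prim).
  rewrite -modnDm modnXm modnMmr modnDm.
  by apply/eqP; congr (_ %% _)%N; rewrite -!muln2; ring.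
(* The outer norm lets the triangle inequality apply once the square is expanded into complex
   terms. *)
rewrite -[leLHS]ger0_norm ?exprn_ge0//.
rewrite normCK rmorph_sum /= mulr_sumr.
have -> : \sum_(l < n.+2) (\sum_(j < n.+2) f j) * (f l)^*
        = \sum_(m < n.+2) f m * (n.+2%:R * (n.+2 %| m.*2)%N%:R).
  under eq_bigr => l _.
    rewrite (reindex_inj (addrI l)) mulr_suml /=.
    under eq_bigr => m _.
      have -> : f (l + m)%R * (f l)^* = f m * (w ^+ m.*2) ^+ l.
        have f_conj : f l * (f l)^* = 1 by rewrite -normCK f_norm expr1n.
        by rewrite f_add -[RHS]mul1r -f_conj; ring.
      over.
    over.
  rewrite exchange_big; apply: eq_bigr => m _.
  rewrite -mulr_sumr sum_unity_root ?(prim_order_dvd w_prim)//.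
  by rewrite exprAC (prim_expr_order w_prim) expr1n.
rewrite (le_trans (ler_norm_sum _ _ _))//.
under eq_bigr do rewrite normrM f_norm mul1r -natrM normr_nat.
by rewrite -natr_sum ler_nat -big_distrr /= -muln2 leq_mul2l sum_double_dvd.
Qed.

Lemma expiD (R : realType) (s t : R) : expi (s + t) = expi s * expi t.
Proof. by rewrite /expi cosD sinD; congr (_ +i* _)%C; ring. Qed.

Lemma expi0 (R : realType) : expi 0 = 1 :> R[i].
Proof. by rewrite /expi cos0 sin0. Qed.

Lemma expiMn (R : realType) (t : R) (n : nat) : expi (t *+ n) = expi t ^+ n.
Proof.
elim: n => [|n IHn]; first by rewrite mulr0n expi0.
by rewrite mulrS expiD exprS IHn.
Qed.

(** By the double-angle formula, cos t = 1 would force sin (t / 2) = 0, although 0 < t / 2 < pi. *)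
Lemma expi_neq1 [R : realType] [t : R] : 0 < t < 2 * pi -> expi t != 1.
Proof.
move=> /andP[t_gt0 t_lt]; apply/eqP => -[cos1 _].
have sin_gt0 : 0 < sin (t / 2).
  by apply: sin_gt0_pi; rewrite divr_gt0//= ltr_pdivrMr// mulrC.
have := cos_mulr2n (t / 2); rewrite -(mulr_natr (t / 2)) divfK// cos1.
have := cos2Dsin2 (t / 2); nra.
Qed.

Lemma expi_prim_root (R : realType) (n : nat) :
  (0 < n)%N -> n.-primitive_root (expi (2 * pi / n%:R : R)).
Proof.
move=> n_gt0; have n_neq0 : n%:R != 0 :> R by rewrite pnatr_eq0 -lt0n.
have n_pos : 0 < n%:R :> R by rewrite ltr0n.
apply/andP; split=> //; apply/forallP => i; rewrite unity_rootE -expiMn.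
have [->|i_neqn] := eqVneq i.+1 n.
  rewrite -(mulr_natr (_ / _)) divfK// /expi mulr_natl cos2pi.
  by rewrite -[pi *+ 2]add0r sinD2pi sin0 !eqxx.
rewrite eqbF_neg expi_neq1// -(mulr_natr (_ / _)) mulrAC divr_gt0 ?mulr_gt0 ?pi_gt0//=.
rewrite ltr_pdivrMr// ltr_pM2l ?mulr_gt0 ?pi_gt0// ltr_nat.
by rewrite ltn_neqAle i_neqn ltn_ord.
Qed.

Lemma rademacherE (R : realType) (p : nat -> nat) (k : nat)
    (g : vilenkin_group p) :
  rademacher R k g = expi (2 * pi / (p k)%:R) ^+ (g k : 'Z_(p k)).
Proof. by rewrite -expiMn /rademacher -(mulr_natr (_ / _)) [in RHS]mulrAC. Qed.

Lemma normc_ge0 (R : rcfType) (z : R[i]) : 0 <= ComplexField.Normc.normc z.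
Proof. by case: z => u v; exact: sqrtr_ge0. Qed.

Lemma Linfty_norm_le d (T : measurableType d) (R : realType)
    (mu : {measure set T -> \bar R}) (f : T -> R[i]) (B : R) :
  0 <= B -> (forall x, ComplexField.Normc.normc (f x) <= B) ->
  (Linfty_norm mu f <= B%:E)%E.
Proof.
(* On a space of measure zero [Lnorm] is 0 by convention; that branch is closed by [B_ge0]. *)
move=> B_ge0 f_le; rewrite /Linfty_norm unlock; case: ifP => _ //.
apply/ess_supP/nearW => x /=.
by rewrite lee_fin ger0_norm// normc_ge0.
Qed.

(** Otherwise N bounds the tail and the sum of the first m values bounds the rest, so their total is
    a finite upper bound. *)
Lemma unbounded_above [R : realType] [p : nat -> nat] (m N : nat) :
  ereal_sup (range (fun k => ((p k)%:R : R)%:E)) = +oo%E ->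
  exists2 k, (m <= k)%N & (N <= p k)%N.
Proof.
move=> p_sup; apply: contrapT => no_k.
have : (ereal_sup (range (fun k => ((p k)%:R : R)%:E))
        <= (N + \sum_(i < m) p i)%:R%:E)%E.
  apply: ge_ereal_sup => _ [k _ <-]; rewrite lee_fin ler_nat.
  have [k_ge|k_lt] := leqP m k.
    rewrite (@leq_trans N) ?leq_addr// ltnW// ltnNge.
    by apply/negP => N_le; apply: no_k; exists k.
  by rewrite (bigD1 (Ordinal k_lt))//= addnCA leq_addr.
by rewrite p_sup leye_eq.
Qed.

(** Restoring the term j = 0, which is 1, gives a full quadratic sum, of squared modulus at most 2(n
    + 2) <= 4(n + 1). Removing it again costs 1 <= sqrt (n + 1), whence 3 = 2 + 1. *)
Lemma quadratic_chirp_bound (R : realType) (n x : nat) :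
  ComplexField.Normc.normc
    (\sum_(j < n.+1) expi (2 * pi / n.+2%:R : R) ^+ (j.+1 ^ 2 + x * j.+1))
  <= 3 * Num.sqrt n.+1%:R.
Proof.
set w := expi _; set S := \sum_(j < n.+1) _.
have := @quadratic_sum_norm _ _ w x (expi_prim_root R n.+2 isT) isT.
rewrite big_ord_recl /= muln0 expr0.
have -> : \sum_(i < n.+1) w ^+ (lift ord0 i ^ 2 + x * lift ord0 i) = S by [].
have -> : `|1 + S| = (ComplexField.Normc.normc (1 + S))%:C%C by [].
have -> : n.+2.*2%:R = (n.+2.*2%:R : R)%:C%C by rewrite rmorph_nat.
rewrite -rmorphXn lecR => S1_le.
have sqrt_ge1 : 1 <= Num.sqrt n.+1%:R :> R by rewrite -[leLHS]sqrtr1 ler_sqrt ?ler1n.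
have {}S1_le : ComplexField.Normc.normc (1 + S) <= 2 * Num.sqrt n.+1%:R.
  rewrite -(@ler_pXn2r _ 2)// ?nnegrE ?normc_ge0 ?mulr_ge0 ?sqrtr_ge0//.
  rewrite (le_trans S1_le)// exprMn sqr_sqrtr// -natrX -natrM ler_nat; lia.
have : `|S| <= `|1 + S| + 1.
  by have := ler_normB (1 + S) 1; rewrite addrAC subrr add0r normr1.
rewrite -[`|S|]/(ComplexField.Normc.normc S)%:C%C.
rewrite -[`|1 + S|]/(ComplexField.Normc.normc (1 + S))%:C%C.
rewrite -(rmorph1 (real_complex R)) -rmorphD lecR; lra.
Qed.

(** With b = 1/alpha - 1/2 > 0, the right side is q^b sqrt q, so q > D^(1/b) suffices. *)
Lemma sqrt_lt_powR [R : realType] [alpha D : R] :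
  0 < alpha < 2 -> 0 < D ->
  exists N, forall q : nat, (N <= q)%N -> D * Num.sqrt q%:R < q%:R `^ alpha^-1.
Proof.
move=> /andP[alpha_gt0 alpha_lt2] D_gt0.
pose b := alpha^-1 - 2^-1.
have b_gt0 : 0 < b by rewrite subr_gt0 ltf_pV2 ?posrE.
exists (Num.truncn (D `^ b^-1)).+1 => q q_ge.
have q_gt : D `^ b^-1 < q%:R.
  by rewrite (lt_le_trans (truncnS_gt _))// ler_nat.
have q_gt0 : 0 < q%:R :> R by rewrite (le_lt_trans _ q_gt)// powR_ge0.
have -> : alpha^-1 = b + 2^-1 by rewrite subrK.
rewrite powRD; last by rewrite (gt_eqF q_gt0) implybT.
rewrite powR12_sqrt ?ltW// ltr_pM2r ?sqrtr_gt0//.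
have D_eq : D = (D `^ b^-1) `^ b.
  by rewrite -powRrM mulVf ?lt0r_neq0// powRr1// ltW.
by rewrite [ltLHS]D_eq gt0_ltr_powR// nnegrE ?powR_ge0 ?(ltW q_gt0).
Qed.

(** The indices are 0, ..., d - 1 with exponent 1, followed by k with exponent j; [d <= k] keeps
    them increasing. *)
Lemma chaos_member (R : realType) (p : nat -> nat) (d k j : nat) :
  (forall i, 1 < p i)%N -> (d <= k)%N -> (0 < j < p k)%N ->
  rademacher_chaos R p d.+1
    (fun g => (\prod_(i < d) rademacher R i g) * rademacher R k g ^+ j).
Proof.
move=> p_gt1 k_ge j_bnd.
exists (fun a => if a == d :> nat then k else a).
exists (fun a => if a == d :> nat then j else 1%N); split.
- by move=> a b ab; have := ltn_ord b; do 2 case: eqP; lia.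
- by move=> a; case: eqP => // _; rewrite p_gt1.
apply/funext => g; rewrite big_ord_recr /= eqxx; congr (_ * _).
by apply: eq_bigr => i _; rewrite ltn_eqF.
Qed.

Lemma normc_expi (R : realType) (t : R) : ComplexField.Normc.normc (expi t) = 1.
Proof. by rewrite /= cos2Dsin2 sqrtr1. Qed.

Lemma normcX (R : rcfType) (z : R[i]) (n : nat) :
  ComplexField.Normc.normc (z ^+ n) = ComplexField.Normc.normc z ^+ n.
Proof.
elim: n => [|n IHn]; first by rewrite ComplexField.Normc.normc1.
by rewrite !exprS ComplexField.Normc.normcM IHn.
Qed.

Lemma normc_rademacher_prod (R : realType) (p : nat -> nat) (d : nat)
    (g : vilenkin_group p) :
  ComplexField.Normc.normc (\prod_(i < d) rademacher R i g) = 1.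
Proof.
elim: d => [|d IHd]; first by rewrite big_ord0 ComplexField.Normc.normc1.
by rewrite big_ord_recr ComplexField.Normc.normcM IHd normc_expi mulr1.
Qed.

Theorem theorem5 (R : realType) (p : nat -> nat)
    (p_ge2 : forall k : nat, (2 <= p k)%N)
    (p_unbounded : ereal_sup (range (fun k : nat => ((p k)%:R : R)%:E)) = +oo%E)
    (mu : probability (vilenkin_group p) R) (mu_haar : haar mu)
    (d : nat) (d_ge1 : (1 <= d)%N)
    (alpha : R) (alpha_ge1 : 1 <= alpha) (alpha_lt2 : alpha < 2) :
  ~ sidon mu (rademacher_chaos R p d) alpha.
Proof.
case: d d_ge1 => // d _ [C C_gt0 sidon_le].
have alpha_gt0 : 0 < alpha by exact: lt_le_trans alpha_ge1.
have alpha_bnd : 0 < alpha < 2 by rewrite alpha_gt0.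
(* [C] is the supposed Sidon constant and 3 comes from [quadratic_chirp_bound]. Below, [N.+2 <= p k]
   ensures that the p k - 1 terms number at least N. *)
have D_gt0 : 0 < C * 3 by rewrite mulr_gt0.
have [N N_lt] := sqrt_lt_powR alpha_bnd D_gt0.
have [k k_ge pk_ge] := unbounded_above d N.+2 p_unbounded.
have [n pk_eq] : exists n, p k = n.+2.
  by exists (p k).-2; have := p_ge2 k; lia.
pose w : R[i] := expi (2 * pi / n.+2%:R).
have w_prim : n.+2.-primitive_root w by exact: expi_prim_root.
have rade_k g : rademacher R k g = w ^+ (g k : 'Z_(p k)).
  by rewrite rademacherE /w -pk_eq.
pose phi (a : 'I_n.+1) (g : vilenkin_group p) :=
  (\prod_(i < d) rademacher R i g) * rademacher R k g ^+ a.+1.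
pose c (a : 'I_n.+1) := w ^+ (a.+1 ^ 2).
have phi_chaos a : rademacher_chaos R p d.+1 (phi a).
  by apply: chaos_member => //; rewrite pk_eq /= ltnS ltn_ord.
have phi_inj : injective phi.
  (* At the point with all coordinates 1, R_k equals the primitive root [w], whose powers a + 1 and
     b + 1, both below n + 2, determine a and b once the nonzero factor [u] is cancelled. *)
  move=> a b /(congr1 (fun f => f (fun i => 1 : 'Z_(p i)))); rewrite /phi.
  set u := \prod_(i < d) _ => /mulfI; have -> : u != 0.
    apply/eqP => u0; have := normc_rademacher_prod R p d (fun i => 1 : 'Z_(p i)).
    by rewrite -/u u0 ComplexField.Normc.normc0 => /eqP; rewrite eq_sym oner_eq0.
  move=> /(_ isT)/eqP; rewrite rade_k /= expr1 (eq_prim_root_expr w_prim).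
  by rewrite !modn_small ?ltnS ?leq_ord// => /eqP[/val_inj].
have := sidon_le _ phi c phi_inj phi_chaos.
apply/negP; rewrite -ltNge.
have norm_le : (Linfty_norm mu (fun g => (\sum_(a < n.+1) c a * phi a g)%R)
                <= (3 * Num.sqrt n.+1%:R)%:E)%E.
  apply: Linfty_norm_le => [|g]; first by rewrite mulr_ge0 ?sqrtr_ge0.
  (* Up to the common unimodular factor, the term is [w] to the power (a + 1)^2 + x(a + 1) with x =
     [g k]. *)
  under eq_bigr => a _.
    rewrite /phi mulrCA rade_k -exprM -exprD.
    over.
  rewrite -mulr_sumr ComplexField.Normc.normcM normc_rademacher_prod mul1r.
  exact: quadratic_chirp_bound.
rewrite (le_lt_trans (lee_wpmul2l _ norm_le)) ?lee_fin ?ltW// -EFinM lte_fin mulrA.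
(* All coefficients have modulus 1, so their l^alpha norm is (n + 1)^(1/alpha). *)
under eq_bigr do rewrite normcX normc_expi expr1n powR1.
by rewrite sumr_const card_ord N_lt; lia.
Qed.
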